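(* Let $\Omega=\{(x_1,x_2)\in\mathbb{R}^2 : x_1^2+x_2^2\le 1\}$. Then any minimizer $u$ of $J_\infty$ over $\hat C$ is not radially symmetric, i.e. $u$ is not of the form $u(x_1,x_2)=z\bigl(\sqrt{x_1^2+x_2^2}\bigr)$ for a function $z\colon[0,1]\to\mathbb{R}$.
   Context: $\hat C$ denotes the set of all functions $u\colon\Omega\to[-1,0]$ that are convex and closed (i.e. lower semicontinuous). Each such $u$ is locally Lipschitz in $\operatorname{int}\Omega$, hence differentiable a.e. For $u\in\hat C$, \[ J_\infty(u)=\int_\Omega \frac{1}{|\nabla u(x)|^2}\,dx \in [0,\infty], \] where the integrand is taken to be $+\infty$ where $\nabla u=0$. *)

(* Defs.v *)
From HB Require Import structures.
From mathcomp Require Import all_boot all_order all_algebra.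
From mathcomp Require Import all_classical all_reals all_analysis.

Set Implicit Arguments.
Unset Strict Implicit.
Unset Printing Implicit Defensive.

Import Order.TTheory GRing.Theory Num.Theory.
Import numFieldNormedType.Exports.

Local Open Scope classical_set_scope.
Local Open Scope ring_scope.

Section Jinfty_minimization.
Variable R : realType.

(* The norm of the product type R * R is the sup norm, so Euclidean norms are
   written out in coordinates. *)
Definition unit_disk : set (R * R) :=
  [set x | x.1 ^+ 2 + x.2 ^+ 2 <= 1].

(* A function Omega -> R is represented by a function on the whole plane whose
   values outside Omega are irrelevant. Lower semicontinuity is relative to
   Omega: in [subspace Omega] the points outside Omega are isolated, so they
   impose no condition. *)
Definition Chat (Omega : set (R * R)) : set (R * R -> R) :=
  [set u | [/\ forall x, Omega x -> -1 <= u x <= 0,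
               @convex_function R (R * R)%type Omega u &
               lower_semicontinuous (fun x : subspace Omega => (u x)%:E)]].

Definition grad (u : R * R -> R) (x : R * R) : R * R :=
  ('D_(1, 0) u x, 'D_(0, 1) u x).

(* The inverse on \bar R satisfies 0^-1 = +oo. The boundary of Omega, where
   [grad u] may depend on the values of u outside Omega, and the points of
   non-differentiability are Lebesgue-null for u in Chat Omega, Omega being a
   disk; the arbitrary values of [grad u] there do not affect the integral. *)
Definition Jinfty (Omega : set (R * R)) (u : R * R -> R) : \bar R :=
  (\int[(lebesgue_measure \x lebesgue_measure)%E]_(x in Omega)
     (((grad u x).1 ^+ 2 + (grad u x).2 ^+ 2)%:E)^-1)%E.

Definition minimizer (T : Type) (C : set T) (J : T -> \bar R) (u : T) : Prop :=
  C u /\ forall v, C v -> (J u <= J v)%E.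

Definition radially_symmetric (Omega : set (R * R)) (u : R * R -> R) : Prop :=
  exists z : R -> R,
    forall x, Omega x -> u x = z (Num.sqrt (x.1 ^+ 2 + x.2 ^+ 2)).

End Jinfty_minimization.

Arguments unit_disk : clear implicits.

(* Main.v *)
Require Import Defs.
From mathcomp Require Import all_boot all_order all_algebra.
From mathcomp Require Import all_classical all_reals all_analysis.
From mathcomp Require Import measurable_realfun.
From mathcomp Require Import ring lra.

(** For a radial [u = z(|x|)] in the class, [z] is convex and nondecreasing on
[[0, 1]] and rises by at most 1, and [J u] is the integral of
[2 pi r / z'(r)^2].  By the tangent line inequality
[1 / d^2 >= 3 / g^2 - 2 d / g^3] with [g(r) = (4/3) r^(1/3)], the Euler-Lagrange
slope, this is at least [27/32] times the area of the disk.  So it suffices to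
find one non-radial competitor below that value.

The competitor is the roof [max (|x1| - 1, 5/3 (|x2| - 1))].  Its gradient has
norm 1 where [|x2| < 2/5 + 3/5 |x1|] and norm [5/3] where
[|x2| > 2/5 + 3/5 |x1|], so that [J] is the area of the disk minus [16/25] of
the area of the second, steep region.  Slicing along the first coordinate, with
[1 - x^2 / 2 - x^4 / 2 <= sqrt (1 - x^2) <= 1 - x^2 / 2], gives at least
[104/125] for the steep region and at most [10/3] for the disk, and
[16/25 * 104/125 > 5/32 * 10/3].  Neither the exact value of [pi] nor polar
coordinates occur.

The lower bound for radial functions is obtained on a finite grid, which avoids
almost everywhere differentiability.  On the annulus between [r_k] and
[r_(k+1)], where [r_k = (k/M)^3], convexity bounds the norm of the gradient by
the slope of [z] on the later interval from [r_(k+2)] to [r_(k+3)]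
([grad_radial_le]); these slopes telescope.  The area of a disk of radius [r] is
[r^2] times that of the unit disk ([area_disk]), so the tangent line inequality
turns into an explicit sum ([grid_sum_ge]) that is [27/32] up to an error
[24/M].  The cubic grid makes [r^(1/3)] rational, hence all the terms are
rational functions of [k].

Partial derivatives are limits with a default value 0 when they do not exist.
For [u] this default only increases the integrand ([norm_derive_le]); for the
roof it occurs on a null set ([area_ridge]).  The
gradients are only compared with step functions: the integral of a nonnegative
function is a supremum over simple functions, hence monotone on all nonnegative
functions, measurable or not ([le_integral_nonmeasurable]). *)

Set Implicit Arguments.
Unset Strict Implicit.
Unset Printing Implicit Defensive.

Import Order.TTheory GRing.Theory Num.Theory.
Import numFieldNormedType.Exports.

Local Open Scope classical_set_scope.
Local Open Scope ring_scope.

(** * Integrals and areas *)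

Section integral_bounds.
Context d (T : measurableType d) (R : realType).
Variable mu : {measure set T -> \bar R}.
Local Open Scope ereal_scope.

(** Every simple function below [f] is below [g], so the suprema that define the
    two integrals compare. *)
Lemma le_integral_nonmeasurable (D : set T) (f g : T -> \bar R) :
  (forall x, D x -> 0 <= f x) -> (forall x, D x -> f x <= g x) ->
  \int[mu]_(x in D) f x <= \int[mu]_(x in D) g x.
Proof.
move=> f0 fg; rewrite !ge0_integralE//; last first.
  by move=> x Dx; exact: le_trans (f0 _ Dx) (fg _ Dx).
apply: le_ereal_sup => _ [h hf <-]; exists h => // x.
by apply: (le_trans (hf x)); rewrite !patchE; case: ifPn => // /set_mem /fg.
Qed.

Lemma integral_sum_indic (D : set T) n (c : nat -> \bar R) (S : nat -> set T) :
  measurable D -> (forall i, measurable (S i)) -> (forall i, 0 <= c i) ->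
  \int[mu]_(x in D) (\sum_(i < n) c i * (\1_(S i) x)%:E) =
  \sum_(i < n) c i * mu (S i `&` D).
Proof.
move=> mD mS c0; rewrite ge0_integral_sum//=; last 2 first.
- by move=> i; apply: measurable_funeM; exact/measurable_EFinP/measurable_indic.
- by move=> i x _; rewrite mule_ge0// lee_fin.
apply: eq_bigr => i _; rewrite ge0_integralZl ?integral_indic//.
exact/measurable_EFinP/measurable_indic.
Qed.

End integral_bounds.

Section area.
Variable R : realType.
Local Notation mu := (@lebesgue_measure R).
Local Notation mu2 := (mu \x mu)%E.
Implicit Types (p : {poly R}) (S : set (R * R)).

Lemma measurable_le_set d (T : measurableType d) (f g : T -> R) :
  measurable_fun setT f -> measurable_fun setT g ->
  measurable [set x | f x <= g x].
Proof.
move=> mf mg; rewrite -[X in measurable X]setTI.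
have := measurable_fun_ler mf mg.
by move=> /(_ measurableT [set true] I).
Qed.

Lemma measurable_lt_set d (T : measurableType d) (f g : T -> R) :
  measurable_fun setT f -> measurable_fun setT g ->
  measurable [set x | f x < g x].
Proof.
move=> mf mg; rewrite -[X in measurable X]setTI.
have := measurable_fun_ltr mf mg.
by move=> /(_ measurableT [set true] I).
Qed.

Lemma continuous_horner p : continuous (horner p).
Proof.
by move=> x; apply: differentiable_continuous; apply/derivable1_diffP;
  exact: derivable_horner.
Qed.

Lemma integral_deriv_poly p (a b : R) : a < b ->
  (\int[mu]_(x in `[a, b]) (p^`().[x])%:E = (p.[b] - p.[a])%:E)%E.
Proof.
move=> ab; rewrite (@continuous_FTC2 _ _ (horner p))//.
- by apply: continuous_subspaceT; exact: continuous_horner.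
- split.
  + by move=> x _; exact: derivable_horner.
  + by apply: cvg_at_right_filter; exact: continuous_horner.
  + by apply: cvg_at_left_filter; exact: continuous_horner.
- by move=> x _; rewrite derivE.
Qed.

(** Areas are estimated by slicing, and slice lengths by polynomials given as a
    derivative [p^`()], so that the integral over the slices is read off [p]. *)
Lemma area_ge_poly S p (a b : R) : measurable S -> a < b ->
  (forall x, a < x < b -> 0 <= p^`().[x]) ->
  (forall x, a < x < b -> ((p^`().[x])%:E <= mu (xsection S x))%E) ->
  ((p.[b] - p.[a])%:E <= mu2 S)%E.
Proof.
move=> mS ab p0 pS; rewrite -integral_deriv_poly//.
have mp : measurable_fun [set: R] (fun x => (p^`().[x])%:E).
  apply/measurable_EFinP; apply: continuous_measurable_fun.
  exact: continuous_horner.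
rewrite -integral_itv_obnd_cbnd; last exact: measurable_funTS.
rewrite -integral_itv_bndo_bndc; last exact: measurable_funTS.
rewrite /product_measure1/=.
apply: (@le_trans _ _ (\int[mu]_(x in `]a, b[) (mu \o xsection S) x)%E).
  apply: le_integral_nonmeasurable => x /=; rewrite in_itv/= => xab.
    by rewrite lee_fin p0.
  exact: pS.
apply: ge0_subset_integral => //.
exact: measurable_fun_xsection.
Qed.

Lemma area_le_poly S p (a b : R) : measurable S -> a < b ->
  (forall x y, S (x, y) -> a <= x <= b) ->
  (forall x, a <= x <= b -> (mu (xsection S x) <= (p^`().[x])%:E)%E) ->
  (mu2 S <= (p.[b] - p.[a])%:E)%E.
Proof.
move=> mS ab Sab pS; rewrite -integral_deriv_poly//.
rewrite /product_measure1/= [leRHS]integral_mkcond.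
apply: le_integral_nonmeasurable => // x _.
rewrite patchE; case: ifPn => [/set_mem/=|xab]; first by rewrite in_itv/= => /pS.
rewrite /= (_ : xsection S x = set0) ?measure0//.
rewrite -subset0 => y /xsectionP/Sab xab'.
by move/negP: xab; apply; rewrite inE/= in_itv.
Qed.

(** Curves that are graphs over the first coordinate are null. *)
Lemma area_countable_sections (S : set (R * R)) :
  (forall t : R, countable (xsection S t)) -> mu2 S = 0%E.
Proof.
move=> cS; rewrite /product_measure1/=; apply: integral0_eq => t _ /=.
exact: countable_lebesgue_measure0.
Qed.

End area.

(** * Scaling of areas *)

Section scaling.
Variable R : realType.
Local Notation mu := (@lebesgue_measure R).
Local Notation mu2 := (mu \x mu)%E.

Definition disk (r : R) : set (R * R) :=
  [set x | x.1 ^+ 2 + x.2 ^+ 2 <= r ^+ 2].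

Lemma measurable_disk r : measurable (disk r).
Proof.
apply: measurable_le_set => //; apply: measurable_funD.
  exact: measurable_funX.
exact: measurable_funX.
Qed.

Lemma scaled_pushforward d d' (T : measurableType d) (T' : measurableType d')
    (m : {measure set T -> \bar R}) (c : R) (f : T -> T') :
  0 <= c -> measurable_fun setT f ->
  exists M : {measure set T' -> \bar R},
    forall A, M A = (c%:E * m (f @^-1` A))%E.
Proof.
move=> c0 mf.
by exists (mscale (NngNum c0)
  (measure_function_pushforward__canonical__measure_function_Measure m mf)).
Qed.

(** Both sides are measures of [A], and they agree on intervals. *)
Lemma lebesgue_measure_scale (r : R) (A : set R) : 0 < r -> measurable A ->
  mu A = (r%:E * mu ( *%R r @^-1` A))%E.
Proof.
move=> r0 mA.
have mr : measurable_fun [set: measurableTypeR R]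
    ( *%R r : measurableTypeR R -> measurableTypeR R).
  exact: measurable_funM.
have [M ME] := @scaled_pushforward _ _ _ _ mu _ _ (ltW r0) mr.
rewrite (@lebesgue_measure_unique _ M)//=.
move=> _ [[a b]] _ <-; rewrite /= ME.
have -> : *%R r @^-1` `]a, b]%classic = `]a / r, b / r]%classic.
  by apply/seteqP; split => x /=; rewrite !in_itv/= ltr_pdivrMr// ler_pdivlMr// mulrC.
have e : mu `]a / r, b / r]%classic =
    (if (a < b)%R then ((b - a) / r)%:E else 0%:E).
  rewrite lebesgue_measure_itv/= lte_fin ltr_pM2r ?invr_gt0//.
  by case: ifP => // _; rewrite -EFinD -mulrBl.
rewrite [X in (_ = _ * X)%E]e lebesgue_measure_itv/= lte_fin.
case: ifPn => _; last by rewrite mule0.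
by rewrite -EFinD -EFinM mulrCA divff ?mulr1// gt_eqF.
Qed.

(** Both sides are measures of [S], and they agree on products by the
    one-dimensional case. *)
Lemma area_scale (r : R) (S : set (R * R)) : 0 < r -> measurable S ->
  mu2 S = ((r ^+ 2)%:E * mu2 ((fun x => (r * x.1, r * x.2)%R) @^-1` S))%E.
Proof.
move=> r0 mS.
pose f := (fun x : measurableTypeR R * measurableTypeR R =>
  (r * x.1, r * x.2) : measurableTypeR R * measurableTypeR R).
have mf : measurable_fun setT f.
  apply/measurable_fun_pairP; split; exact: measurable_funM.
have [M ME] := @scaled_pushforward _ _ _ _ mu2 _ _ (sqr_ge0 r) mf.
rewrite (@product_measure_unique _ _ _ _ _ mu mu M)//= => A B mA mB.
have mrr C : measurable C -> measurable ( *%R r @^-1` C).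
  by move=> mC; rewrite -[X in measurable X]setTI; apply: measurable_funM.
rewrite ME.
rewrite [X in (_ * X = _)%E](product_measure1E mu mu (mrr _ mA) (mrr _ mB)).
rewrite (lebesgue_measure_scale r0 mA) (lebesgue_measure_scale r0 mB).
by rewrite expr2 EFinM muleACA.
Qed.

Lemma area_disk (r : R) : 0 <= r -> mu2 (disk r) = ((r ^+ 2)%:E * mu2 (disk 1))%E.
Proof.
rewrite le_eqVlt => /predU1P[<-|r0].
  (* The scaling is invertible only for positive radii; a point is null. *)
  rewrite expr0n mul0e; apply: area_countable_sections => t.
  apply: (sub_countable (B := [set 0])); last exact: countable1.
  apply: subset_card_le => y /xsectionP; rewrite /disk/= expr0n/= => ty.
  by apply/eqP; rewrite -sqrf_eq0 eq_le sqr_ge0 andbT (le_trans _ ty)// lerDr sqr_ge0.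
rewrite (area_scale r0 (measurable_disk r)); congr (_ * mu2 _)%E.
apply/seteqP; split => x /=; rewrite /disk/= !exprMn -mulrDr expr1n;
  by rewrite ger_pMr// exprn_gt0.
Qed.

(** The slice at [x] has half-length [sqrt (1 - x^2) <= 1 - x^2 / 2]. *)
Lemma area_unit_disk_le : (mu2 (disk 1) <= (10 / 3)%:E)%E.
Proof.
pose p : {poly R} := 2 *: 'X - (1 / 3) *: 'X^3.
have pE x : p^`().[x] = 2 - x ^+ 2.
  by rewrite /p derivB !derivZ derivX derivXn !hornerE /=; field.
have -> : 10 / 3 = p.[1] - p.[-1] by rewrite /p !hornerE /=; field.
apply: area_le_poly => //.
- exact: measurable_disk.
- by move=> x y; rewrite /disk/= => h; apply/andP; split; nra.
- move=> x /andP[x1 x2]; rewrite pE.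
  pose h := 1 - x ^+ 2 / 2.
  apply: (@le_trans _ _ (mu `[- h, h]%classic)).
    apply: le_measure; rewrite ?inE//.
      by apply: measurable_xsection; exact: measurable_disk.
    move=> y /xsectionP; rewrite /disk/= in_itv/= => xy.
    have h0 : 0 <= h by rewrite /h; nra.
    have : y ^+ 2 <= h ^+ 2 by rewrite /h; nra.
    rewrite -ler_sqrt ?sqr_ge0// !sqrtr_sqr (ger0_norm h0).
    by rewrite ler_norml.
  rewrite lebesgue_measure_itv/= lte_fin; case: ifPn => _.
    by rewrite -EFinD lee_fin /h; lra.
  by rewrite lee_fin; nra.
Qed.

End scaling.

(** * The roof, a non-radial competitor *)

Section competitor.
Variable R : realType.
Local Notation mu := (@lebesgue_measure R).
Local Notation mu2 := (mu \x mu)%E.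
Implicit Types (f g : R * R -> R) (x w : R * R).

(** Piecewise affine functions are differentiated by exhibiting an exact affine
    expansion near the point in the direction at hand. *)
Definition locally_affine f x w (c : R) :=
  \forall h \near (0 : R), f (h *: w + x) = f x + h * c.

Lemma locally_affine_derive f x w c : locally_affine f x w c -> 'D_w f x = c.
Proof.
move=> fc; apply/cvg_lim => //; apply: cvg_near_cst.
near=> h.
have h0 : h != 0 by near: h; exact: nbhs_dnbhs_neq.
have -> : (f \o shift x) (h *: w) = f x + h * c.
  by near: h; apply: nbhs_dnbhs; exact: fc.
by rewrite addrAC subrr add0r /GRing.scale/= mulKf.
Unshelve. all: by end_near. Qed.

Lemma locally_affine_max f g x w c c' :
  locally_affine f x w c -> locally_affine g x w c' -> g x < f x ->
  locally_affine (fun y => Num.max (f y) (g y)) x w c.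
Proof.
move=> fc gc gf.
have k0 : 0 < `|c' - c| + 1 by rewrite ltr_pwDr.
have e0 : 0 < (f x - g x) / (`|c' - c| + 1) by rewrite divr_gt0// subr_gt0.
near=> h.
have -> : f (h *: w + x) = f x + h * c by near: h.
have -> : g (h *: w + x) = g x + h * c' by near: h.
rewrite (max_l (ltW gf)) max_l//.
suff : h * (c' - c) <= f x - g x by lra.
apply: (le_trans (ler_norm _)); rewrite normrM.
have : `|h| < (f x - g x) / (`|c' - c| + 1) by near: h; exact: (@nbhs0_lt R R _ e0).
rewrite ltr_pdivlMr// => /ltW; apply: le_trans.
by rewrite ler_wpM2l// lerDl.
Unshelve. all: by end_near. Qed.

Lemma locally_affine_maxC f g x w c :
  locally_affine (fun y => Num.max (g y) (f y)) x w c ->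
  locally_affine (fun y => Num.max (f y) (g y)) x w c.
Proof. by apply: filterS => h; rewrite ![Num.max (f _) _]maxC. Qed.

Lemma norm_locally_affine (r t : R) : r != 0 ->
  \forall h \near (0 : R), `|h * t + r| = `|r| + h * (Num.sg r * t).
Proof.
move=> r0.
have t0 : 0 < `|t| + 1 by rewrite ltr_pwDr.
have e0 : 0 < `|r| / (`|t| + 1) by rewrite divr_gt0// normr_gt0.
near=> h.
have : `|h| < `|r| / (`|t| + 1) by near: h; exact: (@nbhs0_lt R R _ e0).
rewrite ltr_pdivlMr// mulrDr mulr1 -normrM => hr.
have {hr} : `|h * t| < `|r|.
  by apply: le_lt_trans hr; rewrite lerDl.
rewrite ltr_norml => /andP[].
have [rp|rn|r00] := ltrgt0P r; last by rewrite r00 eqxx in r0.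
  by move=> h1 h2; rewrite gtr0_sg// gtr0_norm ?mul1r; lra.
move=> h1 h2; rewrite ltr0_sg// ler0_norm; last by lra.
by rewrite mulN1r mulrN; lra.
Unshelve. all: by end_near. Qed.

(** A larger second slope lowers the integrand on a smaller region; [5/3] is about
    the best compromise. *)
Definition roof x : R := Num.max (`|x.1| - 1) (5 / 3 * (`|x.2| - 1)).

(** The points where the second piece of the roof strictly dominates. *)
Definition steep : set (R * R) := [set x | 2 / 5 + 3 / 5 * `|x.1| < `|x.2|].

(** A null set outside of which the roof is locally affine. *)
Definition ridge : set (R * R) :=
  [set x | x.1 = 0] `|` [set x | x.2 = 0] `|`
  [set x | `|x.2| = 2 / 5 + 3 / 5 * `|x.1|].

Lemma flat_piece_locally_affine x w : x.1 != 0 ->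
  locally_affine (fun y => `|y.1| - 1) x w (Num.sg x.1 * w.1).
Proof.
move=> x0; have := norm_locally_affine w.1 x0.
by apply: filterS => h /= -> ; rewrite addrAC.
Qed.

Lemma steep_piece_locally_affine x w : x.2 != 0 ->
  locally_affine (fun y => 5 / 3 * (`|y.2| - 1)) x w (5 / 3 * (Num.sg x.2 * w.2)).
Proof.
move=> x0; have := norm_locally_affine w.2 x0.
by apply: filterS => h /= -> ; ring.
Qed.

Lemma roof_steep_grad x : steep x -> ~ ridge x ->
  (grad roof x).1 ^+ 2 + (grad roof x).2 ^+ 2 = 25 / 9.
Proof.
rewrite /steep/ridge/= => xs /not_orP[/not_orP[/eqP x1 /eqP x2] _].
have lin w : locally_affine roof x w (5 / 3 * (Num.sg x.2 * w.2)).
  apply: locally_affine_maxC; apply: locally_affine_max.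
  - exact: steep_piece_locally_affine.
  - exact: flat_piece_locally_affine.
  - by lra.
rewrite /grad (locally_affine_derive (lin _)) (locally_affine_derive (lin _))/=.
by rewrite mulr0 mulr1 mulr0 expr0n add0r exprMn sqr_sg x2 mulr1; field.
Qed.

Lemma roof_flat_grad x : ~ steep x -> ~ ridge x ->
  (grad roof x).1 ^+ 2 + (grad roof x).2 ^+ 2 = 1.
Proof.
rewrite /steep/ridge/= => xs /not_orP[/not_orP[/eqP x1 /eqP x2] /eqP xr].
have lin w : locally_affine roof x w (Num.sg x.1 * w.1).
  apply: locally_affine_max.
  - exact: flat_piece_locally_affine.
  - exact: steep_piece_locally_affine.
  - by move/negP: xs; rewrite -leNgt le_eqVlt (negbTE xr)/=; lra.
rewrite /grad (locally_affine_derive (lin _)) (locally_affine_derive (lin _))/=.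
by rewrite mulr0 mulr1 expr0n addr0 sqr_sg x1.
Qed.

Lemma measurable_norm1 : measurable_fun setT (fun x : R * R => `|x.1|).
Proof. exact: measurableT_comp. Qed.

Lemma measurable_norm2 : measurable_fun setT (fun x : R * R => `|x.2|).
Proof. exact: measurableT_comp. Qed.

Lemma measurable_crease :
  measurable_fun setT (fun x : R * R => 2 / 5 + 3 / 5 * `|x.1|).
Proof.
by apply: measurable_funD => //; apply: measurable_funM => //;
  exact: measurable_norm1.
Qed.

Lemma measurable_steep : measurable steep.
Proof. exact: measurable_lt_set measurable_crease measurable_norm2. Qed.

Lemma measurable_eq_set d (T : measurableType d) (f g : T -> R) :
  measurable_fun setT f -> measurable_fun setT g ->
  measurable [set x | f x = g x].
Proof.
move=> mf mg.
have -> : [set x | f x = g x] = [set x | f x <= g x] `&` [set x | g x <= f x].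
  by apply/seteqP; split => x /= => [->//|[fg gf]]; apply/le_anti/andP.
by apply: measurableI; exact: measurable_le_set.
Qed.

Lemma measurable_ridge : measurable ridge.
Proof.
apply: measurableU; first apply: measurableU; apply: measurable_eq_set => //.
- exact: measurable_norm2.
- exact: measurable_crease.
Qed.

Lemma area_ridge : mu2 ridge = 0%E.
Proof.
have m1 : measurable ([set x | x.1 = 0] : set (R * R)).
  exact: measurable_eq_set.
have m2 : measurable ([set x | x.2 = 0] : set (R * R)).
  exact: measurable_eq_set.
have m3 := measurable_eq_set measurable_norm2 measurable_crease.
apply: null_set_setU => //; first exact: measurableU.
  apply: null_set_setU => //.
  - have -> : [set x : R * R | x.1 = 0] = [set 0] `*` setT.
      by apply/seteqP; split => x //= -[].
    have m0 : measurable [set 0 : measurableTypeR R] by [].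
    rewrite [LHS](product_measure1E mu mu m0 measurableT).
    by rewrite [X in (X * _)%E](lebesgue_measure_set1 (0 : R)) mul0e.
  - apply: area_countable_sections => t.
    apply: (sub_countable (B := [set 0])); last exact: countable1.
    by apply: subset_card_le => y /xsectionP.
apply: area_countable_sections => t; set z := 2 / 5 + 3 / 5 * `|t|.
apply: (sub_countable (B := [set z; - z])); last first.
  exact/finite_set_countable/finite_set2.
apply: subset_card_le => y /xsectionP/=; rewrite -/z => <-.
by have [y0|y0] := leP 0 y; [left|right] => /=;
  rewrite ?(ger0_norm y0) ?(ltr0_norm y0) ?opprK.
Qed.

Lemma roof_continuous : continuous roof.
Proof.
move=> x; apply: (@continuous_max R (R * R)%type
  (fun y => `|y.1| - 1) (fun y => 5 / 3 * (`|y.2| - 1)) x).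
- apply: cvgB; last exact: cvg_cst.
  apply: cvg_norm; exact: cvg_fst.
- apply: cvgM; first exact: cvg_cst.
  apply: cvgB; last exact: cvg_cst.
  apply: cvg_norm; exact: cvg_snd.
Qed.

Lemma roof_Chat : Chat (unit_disk R) roof.
Proof.
split.
- move=> x; rewrite /unit_disk/= => x1.
  have n1 : `|x.1| <= 1 by rewrite ler_norml; apply/andP; split; nra.
  have n2 : `|x.2| <= 1 by rewrite ler_norml; apply/andP; split; nra.
  have p1 := normr_ge0 x.1; have p2 := normr_ge0 x.2.
  rewrite /roof le_max ge_max; apply/andP; split; first by apply/orP; left; lra.
  by apply/andP; split; lra.
- move=> t x y _ _.
  have : 0 <= t%:num by [].
  have : t%:num <= 1 by [].
  have -> : roof (conv t (x : convex_lmodType _) y) =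
    roof (t%:num * x.1 + (1 - t%:num) * y.1, t%:num * x.2 + (1 - t%:num) * y.2).
    by [].
  have -> : conv t (roof x : R^o) (roof y) =
    t%:num * roof x + (1 - t%:num) * roof y by [].
  move: (t%:num) => {}t t1 t0.
  have nD (a b : R) : `|t * a + (1 - t) * b| <= t * `|a| + (1 - t) * `|b|.
    apply: (le_trans (ler_normD _ _)).
    have t1' : 0 <= 1 - t by lra.
    by rewrite !normrM (ger0_norm t0) (ger0_norm t1').
  have h1 := nD x.1 y.1; have h2 := nD x.2 y.2.
  rewrite {1}/roof/=.
  have m1 z : `|z.1| - 1 <= roof z by rewrite /roof le_max lexx.
  have m2 z : 5 / 3 * (`|z.2| - 1) <= roof z by rewrite /roof le_max lexx orbT.
  have := m1 x; have := m2 x; have := m1 y; have := m2 y.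
  by rewrite ge_max => ? ? ? ?; apply/andP; split; nra.
- move=> x a ax.
  exists [set y | (a%:E < (roof y)%:E)%E] => //.
  have := @continuous_subspaceT _ _ (unit_disk R) roof roof_continuous x.
  move=> /(_ [set r | a < r]); apply.
  by apply: open_nbhs_nbhs; split; [exact: open_gt|rewrite /= -lte_fin].
Qed.

Lemma unit_disk_disk : unit_disk R = disk 1.
Proof. by rewrite /unit_disk /disk expr1n. Qed.

Lemma measurable_unit_disk : measurable (unit_disk R).
Proof. rewrite unit_disk_disk; exact: measurable_disk. Qed.

(** The integrand is at most the step function equal to [9/25] on the steep part,
    1 off it, and with an additional [+oo] on the null set [ridge], where the
    gradient is unspecified. *)
Lemma Jinfty_roof_le :
  (Jinfty (unit_disk R) roof <=
    (9 / 25)%:E * mu2 (steep `&` unit_disk R) + mu2 (~` steep `&` unit_disk R))%E.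
Proof.
pose c (i : nat) : \bar R := nth +oo%E [:: (9 / 25)%:E; 1%E] i.
pose S (i : nat) : set (R * R) := nth ridge [:: steep; ~` steep] i.
have c0 i : (0 <= c i)%E.
  by case: i => [|[|i]]; rewrite /c/= ?nth_nil ?lee_fin ?leey//; lra.
have mS i : measurable (S i).
  case: i => [|[|i]]; rewrite /S/= ?nth_nil.
  - exact: measurable_steep.
  - by apply: measurableC; exact: measurable_steep.
  - exact: measurable_ridge.
have -> : ((9 / 25)%:E * mu2 (steep `&` unit_disk R) +
    mu2 (~` steep `&` unit_disk R))%E =
    (\sum_(i < 3) c i * mu2 (S i `&` unit_disk R))%E.
  rewrite !big_ord_recr big_ord0/= add0e mul1e.
  rewrite (_ : mu2 (S 2 `&` _) = 0%E) ?mule0 ?adde0//.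
  apply: (@subset_measure0 _ _ _ mu2 _ ridge).
  - by apply: measurableI; [exact: measurable_ridge|exact: measurable_unit_disk].
  - exact: measurable_ridge.
  - by move=> x [].
  - exact: area_ridge.
rewrite -integral_sum_indic//; last exact: measurable_unit_disk.
apply: le_integral_nonmeasurable => x Dx.
  by rewrite inve_ge0 lee_fin addr_ge0// sqr_ge0.
rewrite !big_ord_recr big_ord0/= add0e.
have [xr|xr] := pselect (ridge x).
  rewrite [X in (_ + X)%E](_ : _ = +oo%E) ?leey//; last first.
    by rewrite /c/S/= indicE mem_set// mule1.
rewrite [X in (_ + X)%E](_ : _ = 0%E); last first.
  by rewrite /c/S/= indicE memNset// mule0.
rewrite adde0 /c /S/= !indicE.
have [xs|xs] := pselect (steep x).
  rewrite mem_set// memNset ?mule0 ?mule1 ?adde0; last by move/(_ xs).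
  by rewrite (roof_steep_grad xs xr) inver gt_eqF// lee_fin; lra.
rewrite memNset// mem_set// mule0 mule1 add0e.
by rewrite (roof_flat_grad xs xr) inver oner_eq0 lee_fin invr1.
Qed.

(** This polynomial is the lower bound used for the length of the slices of the
    steep region.  It turns negative slightly before [3/5], hence the cut at
    [7/12]. *)
Lemma steep_width_gt0 (z : R) : 0 <= z -> z < 7 / 12 ->
  0 < 6 / 5 - 6 / 5 * z - z ^+ 2 - z ^+ 4.
Proof.
move=> z0 z7.
have z2 : z ^+ 2 <= 7 / 12 * z by nra.
have z4 : z ^+ 4 <= (7 / 12) ^+ 2 * z ^+ 2.
  have -> : z ^+ 4 = z ^+ 2 * z ^+ 2 by ring.
  by rewrite ler_wpM2r ?sqr_ge0//; lra.
by lra.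
Qed.

(** The slice contains the two intervals [2/5 + 3/5 |t| < |y| <= p] with
    [p = 1 - t^2 / 2 - t^4 / 2 <= sqrt (1 - t^2)]. *)
Lemma steep_section_ge (t : R) : `|t| < 7 / 12 ->
  ((6 / 5 - 6 / 5 * `|t| - t ^+ 2 - t ^+ 4)%:E <=
    mu (xsection (steep `&` unit_disk R) t))%E.
Proof.
move=> t7; pose l : R := 2 / 5 + 3 / 5 * `|t|.
pose p : R := 1 - t ^+ 2 / 2 - t ^+ 4 / 2.
have t0 : 0 <= `|t| by [].
have e2 : t ^+ 2 = `|t| ^+ 2 by rewrite real_normK ?num_real.
have e4 : t ^+ 4 = `|t| ^+ 4 by rewrite -[4%N]/(2 * 2)%N !exprM -e2.
have lp : l < p.
  by have := steep_width_gt0 t0 t7; rewrite /l /p -e2 -e4; lra.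
have l0 : 0 < l by rewrite /l; lra.
have p1 : t ^+ 2 + p ^+ 2 <= 1.
  have u0 : 0 <= t ^+ 2 by exact: sqr_ge0.
  have u1 : t ^+ 2 <= 1 by rewrite e2; nra.
  have -> : p = 1 - t ^+ 2 / 2 - (t ^+ 2) ^+ 2 / 2 by rewrite -exprM.
  move: (t ^+ 2) u0 u1 => u u0 u1.
  have : 0 <= u ^+ 2 * ((1 - u) * (3 + u)).
    by rewrite mulr_ge0 ?sqr_ge0// mulr_ge0//; lra.
  by lra.
apply: (@le_trans _ _ (mu (`]l, p]%classic `|` `[- p, - l[%classic))).
  rewrite measureU//; last first.
    rewrite -subset0 => y [] /=; rewrite !in_itv/=; lra.
  have muU : mu `]l, p]%classic = (p - l)%:E.
    by rewrite lebesgue_measure_itv/= lte_fin lp.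
  have muD : mu `[- p, - l[%classic = (p - l)%:E.
    by rewrite lebesgue_measure_itv/= lte_fin ltrN2 lp opprK addrC.
  rewrite [X in (_ <= X + _)%E]muU [X in (_ <= _ + X)%E]muD.
  by rewrite -EFinD lee_fin /l /p; lra.
apply: le_measure; rewrite ?inE.
- exact: measurableU.
- apply: measurable_xsection; apply: measurableI.
    exact: measurable_steep.
  exact: measurable_unit_disk.
move=> y ylp; apply/xsectionP.
have [y1 y2] : l < `|y| /\ `|y| <= p.
  case: ylp; rewrite /= in_itv/= => /andP[y1 y2].
    by rewrite ger0_norm//; lra.
  by rewrite ler0_norm; [split; lra|lra].
split => //; rewrite /unit_disk/=.
rewrite (le_trans _ p1)// lerD2l -(@real_normK _ y) ?num_real//.
by rewrite ler_pXn2r// nnegrE; lra.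
Qed.

(** The halves [0 < x.1] and [x.1 < 0] are sliced separately, so that [|x.1|] is
    a polynomial in [x.1] on each of them: [q 1] serves the first half and
    [q (-1)] the second. *)
Lemma area_steep_ge : ((104 / 125)%:E <= mu2 (steep `&` unit_disk R))%E.
Proof.
pose q (e : R) : {poly R} :=
  (6 / 5) *: 'X - (e * (3 / 5)) *: 'X^2 - (1 / 3) *: 'X^3 - (1 / 5) *: 'X^5.
have qE e (x : R) : (q e)^`().[x] = 6 / 5 - 6 / 5 * (e * x) - x ^+ 2 - x ^+ 4.
  by rewrite /q !derivB !derivZ derivX !derivXn !hornerE /=; field.
have q0 (x : R) : `|x| < 7 / 12 ->
    0 <= 6 / 5 - 6 / 5 * `|x| - x ^+ 2 - x ^+ 4.
  have -> : x ^+ 4 = `|x| ^+ 4.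
    by rewrite -[4%N]/(2 * 2)%N !exprM real_normK ?num_real.
  rewrite -(@real_normK _ x) ?num_real// => x7.
  exact/ltW/steep_width_gt0.
have mSD : measurable (steep `&` unit_disk R).
  by apply: measurableI; [exact: measurable_steep|exact: measurable_unit_disk].
pose Sr := (steep `&` unit_disk R) `&` [set x | 0 < x.1].
pose Sl := (steep `&` unit_disk R) `&` [set x | x.1 < 0].
have mSr : measurable Sr by apply: measurableI => //; exact: measurable_lt_set.
have mSl : measurable Sl by apply: measurableI => //; exact: measurable_lt_set.
have right : (((q 1).[7 / 12] - (q 1).[0])%:E <= mu2 Sr)%E.
  apply: area_ge_poly => //.
  - move=> x /andP[x0 x7]; have := q0 x.
    by rewrite qE mul1r (gtr0_norm x0); exact.
  move=> x /andP[x0 x7]; rewrite qE mul1r.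
  have -> : xsection Sr x = xsection (steep `&` unit_disk R) x.
    apply/seteqP; split => y /xsectionP; first by move=> [h _]; exact/xsectionP.
    by move=> h; apply/xsectionP.
  have := @steep_section_ge x.
  by rewrite (gtr0_norm x0); exact.
have left : (((q (-1)).[0] - (q (-1)).[- (7 / 12)])%:E <= mu2 Sl)%E.
  apply: area_ge_poly => //.
  - move=> x /andP[x7 x0]; have := q0 x.
    by rewrite qE mulN1r (ltr0_norm x0); apply; lra.
  move=> x /andP[x7 x0]; rewrite qE mulN1r.
  have -> : xsection Sl x = xsection (steep `&` unit_disk R) x.
    apply/seteqP; split => y /xsectionP; first by move=> [h _]; exact/xsectionP.
    by move=> h; apply/xsectionP.
  have := @steep_section_ge x.
  by rewrite (ltr0_norm x0); apply; lra.
apply: (@le_trans _ _ (mu2 (Sr `|` Sl))); last first.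
  apply: le_measure; rewrite ?inE//; first exact: measurableU.
  by move=> x [] [].
rewrite [leRHS](measureU mu2)//; last first.
  rewrite -subset0 => x [[_ /= x0] [_ /= x1]].
  by rewrite (lt_gtF x0) in x1.
apply: (le_trans _ (leeD right left)).
by rewrite -EFinD lee_fin /q !hornerE /=; lra.
Qed.

End competitor.

(** * Slopes of even convex functions *)

Section even_convex.
Variables (R : realType) (Z : R -> R).
Hypothesis Z_convex : forall a b t : R, -1 <= a <= 1 -> -1 <= b <= 1 ->
  0 <= t <= 1 -> Z (t * a + (1 - t) * b) <= t * Z a + (1 - t) * Z b.
Hypothesis Z_even : forall a : R, 0 <= a <= 1 -> Z (- a) = Z a.

(** [a] is a convex combination of [b] and [- b], where [Z] takes the same
    value. *)
Lemma even_convex_nondecreasing (a b : R) : 0 <= a -> a <= b -> b <= 1 -> Z a <= Z b.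
Proof.
move=> a0 ab b1.
move: ab; rewrite le_eqVlt => /predU1P[->//|ab].
have b0 : 0 < b by lra.
pose t := (a / b + 1) / 2.
have ab1 : a / b <= 1 by rewrite ler_pdivrMr// mul1r ltW.
have ab0 : 0 <= a / b by rewrite divr_ge0// ltW.
have := @Z_convex b (- b) t.
rewrite Z_even; last by lra.
have -> : t * b + (1 - t) * - b = a by rewrite /t; field; rewrite gt_eqF.
by rewrite -mulrDl addrC subrK mul1r; apply; rewrite /t; lra.
Qed.

Lemma convex_chord (x y w : R) : -1 <= x -> x < y -> y < w -> w <= 1 ->
  (Z y - Z x) * (w - y) <= (Z w - Z y) * (y - x).
Proof.
move=> x1 xy yw w1; pose t := (w - y) / (w - x).
have wx : 0 < w - x by lra.
have t01 : 0 <= t <= 1.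
  by rewrite /t divr_ge0/= ?ler_pdivrMr ?mul1r//; lra.
have := @Z_convex x w t; rewrite (_ : t * x + _ = y); last first.
  by rewrite /t; field; rewrite gt_eqF.
move=> /(_ _ _ t01) Zy.
have {}Zy : Z y <= t * Z x + (1 - t) * Z w by apply: Zy; lra.
have : (w - x) * Z y <= (w - x) * (t * Z x + (1 - t) * Z w) by rewrite ler_pM2l.
have -> : (w - x) * (t * Z x + (1 - t) * Z w) = (w - y) * Z x + (y - x) * Z w.
  by rewrite /t; field; rewrite gt_eqF.
by lra.
Qed.

(** The slopes of a convex function increase: compare [[a, b]] with [[b, p]] and
    then [[b, p]] with [[p, q]]. *)
Lemma convex_slope (a b p q : R) : 0 <= a -> a <= b -> b <= p -> p < q -> q <= 1 ->
  Z b - Z a <= (Z q - Z p) / (q - p) * (b - a).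
Proof.
move=> a0; rewrite le_eqVlt => /predU1P[-> _ _ _|ab]; first by rewrite !subrr mulr0.
move=> bp pq q1.
rewrite mulrAC ler_pdivlMr ?subr_gt0//.
move: bp ab; rewrite le_eqVlt => /predU1P[->|bp] ab.
  by apply: convex_chord; lra.
have h1 : (Z b - Z a) * (p - b) <= (Z p - Z b) * (b - a).
  by apply: convex_chord; lra.
have h2 : (Z p - Z b) * (q - p) <= (Z q - Z p) * (p - b).
  by apply: convex_chord; lra.
rewrite -(@ler_pM2r _ (p - b)) ?subr_gt0//.
have h3 : (Z b - Z a) * (p - b) * (q - p) <= (Z p - Z b) * (b - a) * (q - p).
  by rewrite ler_pM2r ?subr_gt0.
have h4 : (Z p - Z b) * (q - p) * (b - a) <= (Z q - Z p) * (p - b) * (b - a).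
  by rewrite ler_pM2r ?subr_gt0.
by lra.
Qed.

Lemma convex_lipschitz (a b p q : R) : 0 <= a <= p -> 0 <= b <= p ->
  p < q -> q <= 1 -> `|Z b - Z a| <= (Z q - Z p) / (q - p) * `|b - a|.
Proof.
wlog ab : a b / a <= b.
  move=> wl; have [ab|/ltW ba] := leP a b; first exact: wl.
  by move=> ha hb; rewrite distrC (distrC b); exact: wl.
move=> /andP[a0 ap] /andP[b0 bp] pq q1.
have Zab : Z a <= Z b by apply: even_convex_nondecreasing; lra.
by rewrite !ger0_norm ?subr_ge0//; exact: convex_slope.
Qed.

End even_convex.

(** * Directional derivatives controlled by the norm *)

Section directional.
Variable R : realType.
Implicit Types (u : R * R -> R) (x w : R * R).

Definition norm2 x : R := Num.sqrt (x.1 ^+ 2 + x.2 ^+ 2).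

Lemma norm2_ge0 x : 0 <= norm2 x. Proof. exact: sqrtr_ge0. Qed.

Lemma sqr_norm2 x : norm2 x ^+ 2 = x.1 ^+ 2 + x.2 ^+ 2.
Proof. by rewrite sqr_sqrtr// addr_ge0// sqr_ge0. Qed.

Lemma norm2_shift_cvg x w : norm2 (h *: w + x) @[h --> (0 : R)] --> norm2 x.
Proof.
rewrite /norm2; apply: continuous_cvg; first exact: sqrt_continuous.
have c (a b : R) : (h * a + b) ^+ 2 @[h --> (0 : R)] --> b ^+ 2.
  have cab : h * a + b @[h --> (0 : R)] --> b.
    suff : h * a + b @[h --> (0 : R)] --> 0 * a + b by rewrite mul0r add0r.
    by apply: cvgD; [apply: cvgMl; exact: cvg_id|exact: cvg_cst].
  by rewrite expr2; under eq_fun do rewrite expr2; exact: cvgM.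
by apply: cvgD; exact: c.
Qed.

(** The derivative of [norm2] at [x] in the direction [w] is
    [<x, w> / norm2 x].  If [u] has no derivative then ['D_w u x] is 0 and
    the bound is trivial. *)
Lemma norm_derive_le u x w (d : R) : 0 < norm2 x -> 0 <= d ->
  (\forall h \near (0 : R),
    `|u (h *: w + x) - u x| <= d * `|norm2 (h *: w + x) - norm2 x|) ->
  `|'D_w u x| * norm2 x <= d * `|x.1 * w.1 + x.2 * w.2|.
Proof.
move=> x0 d0 uh; set q := (fun h => h^-1 *: ((u \o shift x) (h *: w) - u x)).
have [cq|/dvgP dq] := pselect (cvg (q h @[h --> 0^'])); last first.
  by rewrite /derive -/q dq normr0 mul0r mulr_ge0.
(* Multiply the difference quotients by [norm2 (x + h w) + norm2 x]: the
   difference of the squares is polynomial in [h]. *)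
rewrite -(@ler_pM2r _ 2)// -!mulrA.
pose F h := `|q h| * (norm2 (h *: w + x) + norm2 x).
pose G h := d * `|2 * (x.1 * w.1 + x.2 * w.2) + h * (w.1 ^+ 2 + w.2 ^+ 2)|.
have cF : F h @[h --> 0^'] --> `|'D_w u x| * (norm2 x * 2).
  rewrite /F mulr_natr mulr2n; apply: cvgM; first exact: cvg_norm cq.
  apply: cvgD; last exact: cvg_cst.
  apply: (cvg_trans _ (@norm2_shift_cvg x w)).
  by apply: cvg_app; apply: cvg_within.
have cG : G h @[h --> 0^'] --> d * (`|x.1 * w.1 + x.2 * w.2| * 2).
  have -> : `|x.1 * w.1 + x.2 * w.2| * 2 = `|2 * (x.1 * w.1 + x.2 * w.2)|.
    by rewrite normrM mulrC ger0_norm.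
  apply: cvgM; first exact: cvg_cst.
  apply: cvg_norm; set a := 2 * _; set b := _ + w.2 ^+ 2.
  suff : a + h * b @[h --> (0 : R)^'] --> a + 0 * b by rewrite mul0r addr0.
  apply: cvgD; first exact: cvg_cst.
  by apply: cvgMl; exact: nbhs_dnbhs.
apply: (ler_cvg_to cF cG); near=> h.
have h0 : h != 0 by near: h; exact: nbhs_dnbhs_neq.
have uhw : `|u (h *: w + x) - u x| <= d * `|norm2 (h *: w + x) - norm2 x|.
  by near: h; apply: nbhs_dnbhs.
have n0 : 0 <= norm2 (h *: w + x) + norm2 x by rewrite addr_ge0 ?norm2_ge0.
have e : h * (2 * (x.1 * w.1 + x.2 * w.2) + h * (w.1 ^+ 2 + w.2 ^+ 2)) =
    (norm2 (h *: w + x) - norm2 x) * (norm2 (h *: w + x) + norm2 x).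
  by rewrite -subr_sqr !sqr_norm2 /= /GRing.scale/=; ring.
rewrite /F /G /q normrZ normfV mulrAC -mulrA ler_pdivrMl ?normr_gt0//.
rewrite mulrCA -normrM e normrM (ger0_norm n0) mulrA.
by rewrite [leLHS]mulrC; exact: ler_wpM2r.
Unshelve. all: by end_near. Qed.

End directional.

(** * The discretized radial problem *)

Section grid.
Variable R : realType.

(** The graph of [1 / d^2] lies above its tangent at [d = g]:
    [1 / d^2 - 3 / g^2 + 2 d / g^3 = (g - d)^2 (g + 2 d) / (d^2 g^3)]. *)
Lemma tangent_le_inv (G d g : R) : 0 < g -> 0 <= d -> 0 <= G <= d ^+ 2 ->
  ((3 / g ^+ 2 - 2 * d / g ^+ 3)%:E <= (G%:E)^-1)%E.
Proof.
move=> g0 d0 /andP[]; rewrite le_eqVlt => /predU1P[<-|G0] Gd.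
  by rewrite inver eqxx leey.
rewrite inver gt_eqF// lee_fin.
have d1 : 0 < d.
  by rewrite lt_neqAle d0 andbT; apply/eqP => d00; move: Gd; rewrite -d00 expr0n/=; lra.
apply: (@le_trans _ _ (d ^+ 2)^-1); last by rewrite lef_pV2// posrE exprn_gt0.
rewrite -subr_ge0.
have -> : (d ^+ 2)^-1 - (3 / g ^+ 2 - 2 * d / g ^+ 3) =
    (g - d) ^+ 2 * (g + 2 * d) / (d ^+ 2 * g ^+ 3).
  by field; rewrite !gt_eqF.
apply: divr_ge0; last by apply: mulr_ge0; apply: exprn_ge0; lra.
by apply: mulr_ge0; [exact: sqr_ge0|lra].
Qed.

(** The annulus area is proportional to [P = K^6 - (K - 1)^6], and
    [6 K^5 - 15 K^4 <= P <= 6 K^5].  The upper bound [6 K^2 / M^3] for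
    [P / K^3 / M^3] is at most twice the width of the later interval on which
    the slope [d] is measured; this makes the terms in [d] telescope. *)
Lemma grid_term_ge (K M d : R) : 1 <= K -> 0 < M -> 0 <= d ->
  27 / 16 * ((6 * K ^+ 3 - 15 * K ^+ 2) / M ^+ 4 -
    d * (((K + 2) / M) ^+ 3 - ((K + 1) / M) ^+ 3)) <=
  (3 / (4 / 3 * (K / M)) ^+ 2 - 2 * d / (4 / 3 * (K / M)) ^+ 3) *
    (((K / M) ^+ 3) ^+ 2 - (((K - 1) / M) ^+ 3) ^+ 2).
Proof.
move=> K1 M0 d0; pose P := K ^+ 6 - (K - 1) ^+ 6.
have K0 : 0 < K by lra.
have P1 : (6 * K ^+ 3 - 15 * K ^+ 2) * K ^+ 2 <= P.
  rewrite /P -subr_ge0.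
  have -> : K ^+ 6 - (K - 1) ^+ 6 - (6 * K ^+ 3 - 15 * K ^+ 2) * K ^+ 2 =
    15 * K ^+ 2 * (K - 1) + 5 * K ^+ 3 + 5 * K + (K - 1) by ring.
  have ? : 0 <= K ^+ 2 * (K - 1) by rewrite mulr_ge0 ?sqr_ge0//; lra.
  have ? : 0 <= K ^+ 3 by rewrite exprn_ge0// ltW.
  by lra.
have P2 : P <= 2 * ((K + 2) ^+ 3 - (K + 1) ^+ 3) * K ^+ 3.
  rewrite /P -subr_ge0.
  have -> : 2 * ((K + 2) ^+ 3 - (K + 1) ^+ 3) * K ^+ 3 - (K ^+ 6 - (K - 1) ^+ 6) =
    33 * K ^+ 4 + 15 * K ^+ 2 - 6 * K ^+ 3 - 6 * K + 1 by ring.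
  have K2 : 1 <= K ^+ 2 by rewrite exprn_ege1.
  have ? : 0 <= K ^+ 3 * (K - 1) by rewrite mulr_ge0 ?exprn_ge0//; lra.
  have ? : 0 <= K * (K - 1) by rewrite mulr_ge0//; lra.
  have ? : 0 <= K ^+ 4 by rewrite exprn_ge0// ltW.
  by lra.
have -> : (3 / (4 / 3 * (K / M)) ^+ 2 - 2 * d / (4 / 3 * (K / M)) ^+ 3) *
    (((K / M) ^+ 3) ^+ 2 - (((K - 1) / M) ^+ 3) ^+ 2) =
    27 / 16 * (P / K ^+ 2 / M ^+ 4 - d * (P / K ^+ 3 / 2) / M ^+ 3).
  by rewrite /P; field; rewrite !gt_eqF.
have -> : d * (((K + 2) / M) ^+ 3 - ((K + 1) / M) ^+ 3) =
    d * ((K + 2) ^+ 3 - (K + 1) ^+ 3) / M ^+ 3.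
  by field; rewrite gt_eqF.
rewrite ler_pM2l; last by lra.
apply: lerB.
  rewrite ler_pM2r ?invr_gt0 ?exprn_gt0//.
  by rewrite ler_pdivlMr ?exprn_gt0.
rewrite ler_pM2r ?invr_gt0 ?exprn_gt0// ler_wpM2l//.
by rewrite ler_pdivrMr// ler_pdivrMr ?exprn_gt0//; lra.
Qed.

Lemma sum_cubes_squares N :
  \sum_(i < N) (6 * i.+1%:R ^+ 3 - 15 * i.+1%:R ^+ 2) =
  3 / 2 * N%:R ^+ 2 * (N%:R + 1) ^+ 2 - 5 / 2 * N%:R * (N%:R + 1) * (2 * N%:R + 1) :> R.
Proof.
elim: N => [|N IH]; first by rewrite big_ord0; field.
by rewrite big_ord_recr/= IH -natr1; field.
Qed.

(** In the limit the sum is [27/16 * 3/2 - 27/16]: the first part comes from the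
    sum of the [6 K^3], the second one from the total rise of [zeta]. *)
Lemma grid_sum_ge N (zeta : nat -> R) (M := (N%:R + 2) : R)
    (r := fun k : nat => (k%:R / M) ^+ 3) :
  (forall i, (i < N)%N -> zeta i.+2 <= zeta i.+3) ->
  zeta N.+2 - zeta 2 <= 1 ->
  27 / 32 - 24 / M <=
  \sum_(i < N) (3 / (4 / 3 * (i.+1%:R / M)) ^+ 2 -
      2 * ((zeta i.+3 - zeta i.+2) / (r i.+3 - r i.+2)) /
        (4 / 3 * (i.+1%:R / M)) ^+ 3) * (r i.+1 ^+ 2 - r i ^+ 2).
Proof.
move=> zeta_nd zeta1.
have N0 : 0 <= N%:R :> R by [].
have M0 : 0 < M by rewrite /M; lra.
have rlt k : r k < r k.+1.
  by rewrite /r ltr_pXn2r ?nnegrE ?divr_ge0 ?ltr_pM2r ?invr_gt0 ?ltr_nat//; exact: ltW.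
pose a (i : nat) : R := 27 / 16 *
  ((6 * i.+1%:R ^+ 3 - 15 * i.+1%:R ^+ 2) / M ^+ 4 - (zeta i.+3 - zeta i.+2)).
apply: (@le_trans _ _ (\sum_(i < N) a i)).
  rewrite /a -mulr_sumr sumrB -mulr_suml sum_cubes_squares.
  have -> : \sum_(i < N) (zeta i.+3 - zeta i.+2) = zeta N.+2 - zeta 2.
    rewrite -(big_mkord xpredT (fun i => zeta i.+3 - zeta i.+2)).
    by rewrite (telescope_sumr (fun i => zeta i.+2)).
  (* In terms of [M] rather than [N], [T = 3/2 M^4 - 14 M^3 + O(M^2)], and the
     remainder is positive. *)
  set T := (X in X / M ^+ 4).
  have : 3 / 2 - 14 / M <= T / M ^+ 4.
    rewrite ler_pdivlMr ?exprn_gt0// -subr_ge0.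
    have -> : T - (3 / 2 - 14 / M) * M ^+ 4 = 42 * M ^+ 2 - 101 / 2 * M + 21.
      by rewrite /T /M; field; rewrite gt_eqF.
    have : 0 <= (42 * M - 101 / 4) ^+ 2 by exact: sqr_ge0.
    by lra.
  have : 0 <= M^-1 by rewrite invr_ge0 ltW.
  by lra.
apply: ler_sum => i _; rewrite /a.
have drr : 0 < r i.+3 - r i.+2 by rewrite subr_gt0.
have := @grid_term_ge i.+1%:R M ((zeta i.+3 - zeta i.+2) / (r i.+3 - r i.+2)).
have e1 : i.+1%:R + 2 = i.+3%:R :> R by rewrite -natrD addn2.
have e2 : i.+1%:R + 1 = i.+2%:R :> R by rewrite natr1.
have e3 : i.+1%:R - 1 = i%:R :> R by rewrite -natr1 addrK.
rewrite e1 e2 e3 -/(r i.+3) -/(r i.+2) -/(r i.+1) -/(r i).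
rewrite divfK ?gt_eqF//; apply => //; first by rewrite ler1n.
by rewrite divr_ge0 ?subr_ge0 ?zeta_nd// ltW.
Qed.

End grid.

(** * Lower bound for radial functions *)

Section radial.
Variables (R : realType) (u : R * R -> R).
Local Notation mu := (@lebesgue_measure R).
Local Notation mu2 := (mu \x mu)%E.
Hypothesis u_Chat : Chat (unit_disk R) u.
Hypothesis u_radial : radially_symmetric (unit_disk R) u.

Definition profile (r : R) : R := u (r, 0).

Lemma unit_diskE (x : R * R) : unit_disk R x <-> norm2 x <= 1.
Proof.
by rewrite /unit_disk/= -sqr_norm2 expr_le1 ?norm2_ge0.
Qed.

Lemma radial_profile x : norm2 x <= 1 -> u x = profile (norm2 x).
Proof.
move=> x1; have [z uz] := u_radial.
rewrite /profile (uz x) ?unit_diskE// (uz (norm2 x, 0)).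
  by rewrite /= expr0n addr0 sqrtr_sqr ger0_norm ?norm2_ge0.
by rewrite /unit_disk/= expr0n addr0 expr_le1 ?norm2_ge0.
Qed.

Lemma profile_itv (r : R) : -1 <= r <= 1 -> -1 <= profile r <= 0.
Proof.
move=> r1; have [+ _ _] := u_Chat; apply.
by rewrite /unit_disk/= expr0n addr0; nra.
Qed.

Lemma profile_even (r : R) : 0 <= r <= 1 -> profile (- r) = profile r.
Proof.
move=> r1; have [z uz] := u_radial.
have rD (e : R) : e ^+ 2 = r ^+ 2 -> unit_disk R (e, 0).
  by move=> er; rewrite /unit_disk/= expr0n addr0 er; nra.
by rewrite /profile !uz/= ?sqrrN//; apply: rD; rewrite ?sqrrN.
Qed.

Lemma profile_convex (a b t : R) : -1 <= a <= 1 -> -1 <= b <= 1 -> 0 <= t <= 1 ->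
  profile (t * a + (1 - t) * b) <= t * profile a + (1 - t) * profile b.
Proof.
move=> a1 b1 /andP[t0 t1]; have [_ ucvx _] := u_Chat.
have D (r : R) : -1 <= r <= 1 -> ((r, 0) : convex_lmodType (R * R)%type) \in unit_disk R.
  by move=> r1; rewrite inE /unit_disk/= expr0n addr0; nra.
have := ucvx (Itv01 t0 t1) _ _ (D _ a1) (D _ b1).
rewrite /profile.
have -> : conv (Itv01 t0 t1) ((a, 0) : convex_lmodType (R * R)%type) (b, 0) =
    (t * a + (1 - t) * b, 0).
  by congr (_, _); rewrite /= !scaler0 addr0.
by [].
Qed.

(** In the direction [w] the derivative is at most [d |<x, w>| / norm2 x] with
    [d] the slope on [[p, q]], and the squares of these bounds for the two
    coordinate directions add up to [d^2]. *)
Lemma grad_radial_le x (p q : R) : 0 < norm2 x -> norm2 x < p -> p < q -> q <= 1 ->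
  (grad u x).1 ^+ 2 + (grad u x).2 ^+ 2 <=
  ((profile q - profile p) / (q - p)) ^+ 2.
Proof.
move=> x0 xp pq q1; set d := _ / (q - p).
have d0 : 0 <= d.
  rewrite divr_ge0 ?subr_ge0//; last exact: ltW.
  apply: (even_convex_nondecreasing profile_convex profile_even) => //; last exact: ltW.
  by lra.
have D w : `|'D_w u x| * norm2 x <= d * `|x.1 * w.1 + x.2 * w.2|.
  apply: norm_derive_le => //; near=> h.
  have hp : norm2 (h *: w + x) < p.
    by near: h; apply: (cvgr_lt _ (@norm2_shift_cvg _ x w)).
  rewrite !radial_profile; [|lra..].
  apply: (convex_lipschitz profile_convex profile_even) => //.
    by rewrite norm2_ge0 ltW.
  by rewrite norm2_ge0 ltW.
have sqD w : ('D_w u x) ^+ 2 * norm2 x ^+ 2 <= d ^+ 2 * (x.1 * w.1 + x.2 * w.2) ^+ 2.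
  have := D w; rewrite -{1}(ger0_norm (norm2_ge0 x)) -{1}(ger0_norm d0) -!normrM.
  rewrite -(@ler_pXn2r _ 2)// ?nnegrE// !real_normK ?num_real//.
  by rewrite !exprMn.
rewrite /grad/=.
have := sqD (1, 0); have := sqD (0, 1); rewrite /= !mulr0 !mulr1 addr0 add0r => D2 D1.
rewrite -(@ler_pM2r _ (norm2 x ^+ 2)) ?exprn_gt0// mulrDl.
by apply: (le_trans (lerD D1 D2)); rewrite -mulrDr -sqr_norm2.
Unshelve. all: by end_near. Qed.

Lemma disk_norm2 (r : R) (x : R * R) : 0 <= r -> disk r x <-> norm2 x <= r.
Proof.
by move=> r0; rewrite /disk/= -sqr_norm2 ler_pXn2r// nnegrE norm2_ge0.
Qed.

(** The tangent line inequality is summed over the annuli [A k].  Its right-hand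
    side [c k] may be negative, and is replaced by its positive part to keep the
    step function under the integral nonnegative. *)
Lemma radial_Jinfty_ge N (delta : R) : mu2 (unit_disk R) = delta%:E ->
  (((27 / 32 - 24 / (N%:R + 2)) * delta)%:E <= Jinfty (unit_disk R) u)%E.
Proof.
move=> areaD; have delta0 : 0 <= delta by rewrite -lee_fin -areaD measure_ge0.
pose M : R := N%:R + 2.
have N0 : 0 <= N%:R :> R by [].
have M0 : 0 < M by rewrite /M; lra.
pose r (k : nat) : R := (k%:R / M) ^+ 3.
have r0 k : 0 <= r k by rewrite /r exprn_ge0// divr_ge0// ltW.
have rlt k : r k < r k.+1.
  by rewrite /r ltr_pXn2r ?nnegrE ?divr_ge0 ?ltr_pM2r ?invr_gt0 ?ltr_nat//; exact: ltW.
have rle : {homo r : i j / (i <= j)%N >-> i <= j}.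
  by apply: (homo_leq (@lexx _ R) (@le_trans _ R)) => k; exact: ltW.
have rM : r N.+2 = 1.
  by rewrite /r (_ : N.+2%:R = M) ?divff ?expr1n ?gt_eqF// /M -natrD addn2.
have r1 k : (k <= N.+2)%N -> r k <= 1 by move=> kN; rewrite -rM rle.
pose zeta k := profile (r k).
pose d k := (zeta k.+3 - zeta k.+2) / (r k.+3 - r k.+2).
pose c k := 3 / (4 / 3 * (k.+1%:R / M)) ^+ 2 -
  2 * d k / (4 / 3 * (k.+1%:R / M)) ^+ 3.
pose A k := disk (r k.+1) `\` disk (r k).
have mA k : measurable (A k) by apply: measurableD; exact: measurable_disk.
have zeta_nd k : (k < N)%N -> zeta k.+2 <= zeta k.+3.
  move=> kN; apply: (even_convex_nondecreasing profile_convex profile_even) => //.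
    exact: ltW.
  exact: r1.
have zeta1 : zeta N.+2 - zeta 2 <= 1.
  have p1 k : (k <= N.+2)%N -> -1 <= zeta k <= 0.
    by move=> kN; apply: profile_itv; rewrite r1// andbT; have := r0 k; lra.
  have /andP[_] := p1 _ (leqnn _); have /andP[] := p1 2 isT; lra.
have areaA k : (k < N)%N ->
    mu2 (A k `&` unit_disk R) = ((r k.+1 ^+ 2 - r k ^+ 2) * delta)%:E.
  move=> kN; rewrite (_ : A k `&` _ = A k); last first.
    apply/setIidl => x [/disk_norm2 xr _]; apply/unit_diskE.
    by apply: le_trans (xr (r0 _)) (r1 _ _); rewrite ltnS ltnW// ltnW.
  have aD l : mu2 (disk (r l)) = (r l ^+ 2 * delta)%:E.
    by rewrite area_disk// -unit_disk_disk areaD -EFinM.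
  have -> : mu2 (A k) = (mu2 (disk (r k.+1)) - mu2 (disk (r k)))%E.
    rewrite -[in RHS](@setIidr _ (disk (r k.+1)) (disk (r k))); last first.
      move=> x /disk_norm2 xr; apply/disk_norm2 => //.
      by apply: le_trans (xr (r0 _)) _; exact: ltW.
    apply: (@measureD _ _ _ mu2); [exact: measurable_disk..|].
    by rewrite [X in (X < _)%E]aD ltry.
  by rewrite !aD -EFinD -mulrBl.
apply: (@le_trans _ _ (\sum_(i < N) (c i * ((r i.+1 ^+ 2 - r i ^+ 2) * delta))%:E)%E).
  rewrite sumEFin lee_fin; under eq_bigr do rewrite mulrA.
  rewrite -mulr_suml ler_wpM2r ?delta0//.
  exact: grid_sum_ge.
apply: (@le_trans _ _
    (\sum_(i < N) (Num.max 0 (c i))%:E * mu2 (A i `&` unit_disk R))%E).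
  apply: lee_sum => i _; rewrite areaA// -EFinM lee_fin.
  rewrite ler_wpM2r ?le_max ?lexx ?orbT//.
  by rewrite -lee_fin -areaA// measure_ge0.
rewrite -(@integral_sum_indic _ _ _ mu2 _ _ (fun i => (Num.max 0 (c i))%:E))//; last 2 first.
- exact: measurable_unit_disk.
- by move=> i; rewrite lee_fin le_max lexx.
apply: le_integral_nonmeasurable => x Dx.
  by apply: sume_ge0 => i _; rewrite mule_ge0// lee_fin// le_max lexx.
have [[k [kN xk]]|xA] := pselect (exists k, (k < N)%N /\ A k x); last first.
  rewrite big1 ?inve_ge0 ?lee_fin ?addr_ge0 ?sqr_ge0// => i _.
  rewrite indicE memNset ?mule0// => xi; apply: xA.
  by exists i; split.
rewrite (bigD1 (Ordinal kN))//= big1 ?adde0; last first.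
  move=> i ik; rewrite indicE memNset ?mule0// => xi.
  have far a b : (a < b)%N -> A a x -> A b x -> False.
    move=> ab [/(disk_norm2 _ (r0 _)) xa _] [_]; apply; apply/disk_norm2 => //.
    by apply: le_trans xa _; exact: rle.
  have : nat_of_ord i != k by apply: contraNneq ik => ik; apply/eqP/val_inj.
  by rewrite neq_ltn => /orP[] /far; apply.
rewrite indicE mem_set// mule1.
have [/(disk_norm2 _ (r0 _)) xk1 xk0] := xk.
have {}xk0 : r k < norm2 x.
  by rewrite ltNge; apply/negP => /(disk_norm2 _ (r0 _)).
have [c0|c0] := leP (c k) 0.
  by rewrite inve_ge0 lee_fin addr_ge0// sqr_ge0.
apply: tangent_le_inv.
- by rewrite mulr_gt0// divr_gt0.
- by rewrite divr_ge0// subr_ge0 ?zeta_nd// ltW.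
- rewrite addr_ge0 ?sqr_ge0//=; apply: grad_radial_le => //.
  + by apply: le_lt_trans xk0.
  + by apply: le_lt_trans xk1 _.
  + exact: r1.
Qed.

End radial.

(** * Comparison *)

Theorem theorem5 (R : realType) (u : (R * R)%type -> R)
    (hu : minimizer (Chat (unit_disk R)) (Jinfty (unit_disk R)) u) :
  ~ radially_symmetric (unit_disk R) u.
Proof.
move=> urad; have [uC /(_ _ (@roof_Chat R))] := hu.
have mS := @measurable_steep R; have mD := @measurable_unit_disk R.
have := @area_steep_ge R; have := @area_unit_disk_le R; rewrite -unit_disk_disk.
have := @Jinfty_roof_le R.
set mu2 := (lebesgue_measure \x lebesgue_measure)%E.
set D := unit_disk R; set S := @steep R.
have areaD : mu2 D = (mu2 (S `&` D) + mu2 (~` S `&` D))%E.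
  rewrite -(measureU mu2); last 3 first.
  - exact: measurableI.
  - by apply: measurableI => //; exact: measurableC.
  - by rewrite setIACA setICr set0I.
  by rewrite -setIUl setUCr setTI.
have : (0 <= mu2 (S `&` D))%E by exact: measure_ge0.
have : (0 <= mu2 (~` S `&` D))%E by exact: measure_ge0.
move: areaD; case: (mu2 (S `&` D)) => [a| |]; case: (mu2 (~` S `&` D)) => [b| |]//=;
  move=> areaD; rewrite areaD//.
rewrite !lee_fin => b0 a0 Jroof ab aS Ju.
have {}Jroof : (Jinfty D (@roof R) <= (9 / 25 * a + b)%:E)%E by exact: Jroof.
(* With [M > 8000] the error [24 / M * 10 / 3] is below [1/100], which is less
   than the gap between [16/25 * 104/125] and [5/32 * 10/3]. *)
pose N := Num.truncn (8000 : R); pose M : R := N%:R + 2.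
have M8 : 8000 < M.
  have : 8000 < N.+1%:R :> R by exact: truncnS_gt.
  by rewrite -natr1 /M; lra.
have := radial_Jinfty_ge uC urad N areaD; rewrite -/M => lb.
have := le_trans lb (le_trans Ju Jroof); rewrite lee_fin.
have Mi : M^-1 <= 8000^-1 by rewrite lef_pV2 ?posrE; lra.
have : M^-1 * (a + b) <= 8000^-1 * (10 / 3).
  by apply: ler_pM => //; rewrite ?invr_ge0; lra.
lra.
Qed.
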